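(* Let $n,\ell$ be positive integers, let $r>1$ and $p_1,\dots,p_\ell>0$ be real numbers, let $A_1,\dots,A_\ell\in\mathcal{H}_n$, and let $X_1,\dots,X_\ell\in\mathcal{M}_n$ be such that $$\sum_{i=1}^{\ell}p_i^{\frac{1}{1-r}}X_i^*X_i\leq\left(\sum_{i=1}^{\ell}p_i^{\frac{1}{1-r}}\right)I_n.$$ Then $$\sum_{j=1}^{k}\lambda_j\left(\left|\sum_{i=1}^{\ell}X_i^*A_iX_i\right|^r\right)\leq\left(\sum_{i=1}^{\ell}p_i^{\frac{1}{1-r}}\right)^{r-1}\sum_{j=1}^{k}\lambda_j\left(\sum_{i=1}^{\ell}p_iX_i^*|A_i|^rX_i\right)$$ for $1\leq k\leq n$.
   Context: $\mathcal{M}_n$ denotes the $C^*$-algebra of $n\times n$ complex matrices, $I_n$ its identity matrix, and $\mathcal{H}_n$ the set of Hermitian matrices in $\mathcal{M}_n$. For $A,B\in\mathcal{H}_n$, $A\leq B$ means $\langle Ax,x\rangle\leq\langle Bx,x\rangle$ for all $x\in\mathbb{C}^n$. For $A\in\mathcal{H}_n$, $\lambda_1(A)\geq\lambda_2(A)\geq\cdots\geq\lambda_n(A)$ denote its eigenvalues in decreasing order, counted with multiplicity. $|A|=(A^*A)^{1/2}$, and powers of positive semidefinite matrices are defined by the functional calculus. *)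

(* Defs.v *)
From HB Require Import structures.
From mathcomp Require Export all_boot all_order all_algebra.
From mathcomp Require Export complex.
From mathcomp Require Export reals exp.
Set Implicit Arguments.
Unset Strict Implicit.
Unset Printing Implicit Defensive.
Import Order.TTheory GRing.Theory Num.Theory.
Local Open Scope ring_scope.
Local Open Scope complex_scope.
Local Open Scope sesquilinear_scope.

(* The complex numbers are [R[i]] with [R] a model of the reals; [A ^t*] is the
   conjugate transpose, and [A \is hermsymmx] says that [A] is Hermitian. *)

(* The inner product is linear in its first argument, so that
   <A x, x> = x^* A x.  The order of [R[i]] compares real parts of numbers with
   equal imaginary parts; for Hermitian matrices both sides are real. *)
Definition loewner_le (R : realType) (n : nat) (A B : 'M[R[i]]_n) : Prop :=
  forall x : 'cV[R[i]]_n,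
    (x ^t* *m (A *m x)) 0 0 <= (x ^t* *m (B *m x)) 0 0.

(* Functional calculus, for Hermitian [A]: if A = P^-1 diag(d) P with P unitary
   and d real, then f(A) = P^-1 diag(f(d)) P. *)
Definition mx_calculus (R : realType) (n : nat) (f : R -> R)
    (A : 'M[R[i]]_n) : 'M[R[i]]_n :=
  invmx (spectralmx A)
  *m diag_mx (map_mx (fun z : R[i] => (f (complex.Re z))%:C) (spectral_diag A))
  *m spectralmx A.

(* Meant for positive semidefinite [A] and [s > 0] ([powR 0 s = 0] then). *)
Definition mx_pow (R : realType) (n : nat) (A : 'M[R[i]]_n) (s : R) :
    'M[R[i]]_n :=
  mx_calculus (fun t => powR t s) A.

Definition mx_abs (R : realType) (n : nat) (A : 'M[R[i]]_n) : 'M[R[i]]_n :=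
  mx_pow (A ^t* *m A) 2^-1.

(* [spectral_diag A] lists the eigenvalues of a normal matrix with multiplicity,
   in no specified order; those of a Hermitian matrix are real. *)
Definition eigenvalues (R : realType) (n : nat) (A : 'M[R[i]]_n) : seq R :=
  sort >=%R [seq complex.Re (spectral_diag A 0 i) | i : 'I_n].

(* Indices start at 1, as in lambda_1(A) >= ... >= lambda_n(A). *)
Definition lambda (R : realType) (n : nat) (j : nat) (A : 'M[R[i]]_n) : R :=
  (eigenvalues A)`_j.-1.

Lemma eigenvalues_sorted (R : realType) (n : nat) (A : 'M[R[i]]_n) :
  sorted >=%R (eigenvalues A).
Proof. by apply: sort_sorted => x y; rewrite orbC le_total. Qed.

Lemma char_poly_lambda (R : realType) (n : nat) (A : 'M[R[i]]_n) :
  A \is hermsymmx ->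
  char_poly A = \prod_(1 <= j < n.+1) ('X - ((lambda j A)%:C)%:P).
Proof.
move=> hA; have /orthomx_spectralP eA := hermitian_normalmx hA.
have /mxOverP dreal := hermitian_spectral_diag_real hA.
have sz : size (eigenvalues A) = n.
  by rewrite size_sort size_map size_enum_ord.
transitivity (\prod_(x <- eigenvalues A) ('X - (x%:C)%:P)); last first.
  by rewrite (big_nth 0) sz big_add1 /=.
transitivity (char_poly (diag_mx (spectral_diag A))).
  set P := spectralmx A in eA *; set D := diag_mx _ in eA *.
  pose Q := map_mx polyC P; pose Q' := map_mx polyC (invmx P).
  have Q'Q : Q' *m Q = 1%:M by rewrite -map_mxM mulVmx ?spectral_unit // map_mx1.
  have -> : char_poly A = \det (Q' *m char_poly_mx D *m Q).
    congr (\det _); rewrite [in LHS]eA /char_poly_mx !map_mxM mulmxBr mulmxBl.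
    by rewrite mul_mx_scalar -scalemxAl Q'Q scalemx1.
  by rewrite !det_mulmx mulrAC -det_mulmx Q'Q det1 mul1r.
rewrite char_poly_trig ?diag_mx_is_trig //.
rewrite (perm_big _ (permEl (perm_sort _ _))) big_image /=.
apply: eq_bigr => i _; rewrite mxE eqxx mulr1n.
by have /Creal_ReP := dreal 0 i; rewrite -complexRe => ->.
Qed.

(* Main.v *)
Require Import Defs.
From mathcomp Require Import ring lra.
Set Implicit Arguments.
Unset Strict Implicit.
Unset Printing Implicit Defensive.
Import Order.TTheory GRing.Theory Num.Theory.
Local Open Scope ring_scope.
Local Open Scope complex_scope.
Local Open Scope sesquilinear_scope.

(** Write <A x, x> for the quadratic form of A, P for the sum of the
    p_i^(1/(1-r)), B for the sum of the X_i^* A_i X_i and C for the sum of the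
    p_i X_i^* |A_i|^r X_i.  The theorem is a scalar inequality for one unit
    vector, summed over eigenvectors of B.

    Scalar inequality ([powR_qform_le]): |<B x, x>|^r <= P^(r-1) <C x, x> for
    every unit vector x.  In an eigenbasis of A_i, with eigenvalues a_im, the
    number <A_i X_i x, X_i x> is the sum over m of a_im w_im, where w_im >= 0 are
    the squared moduli of the coordinates of X_i x, and <|A_i|^r X_i x, X_i x>
    is the sum of |a_im|^r w_im.  So the claim is a weighted Jensen inequality
    for t^r with weights p_i^(1/(1-r)) w_im and values |a_im| p_i^(1/(r-1)):
    the powers of p_i cancel in weight times value, and leave p_i in weight
    times value to the r.  The hypothesis on the X_i says that the total weight
    is at most P, which is what [jensen_subprob] asks for.

    Passage to sums of eigenvalues: B = Q^* diag(b) Q gives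
    |B|^r = Q^* diag(|b|^r) Q ([mx_pow_abs_spectral]), so the left-hand side is
    at most the sum of the k largest |b_j|^r, say for j in the set S.  For j in S apply
    the scalar inequality to the j-th eigenvector of B, where <B x, x> = b_j.
    The sum over S of <C x_j, x_j> over k orthonormal vectors x_j is at most the
    sum of the k largest eigenvalues of C, by the Ky Fan inequality ([ky_fan]).
    The Ky Fan inequality also yields the comparison of the eigenvalues of |B|^r
    with the |b_j|^r ([sum_lambda_rudiag_le]), instead of an argument that
    eigenvalues are unique up to order. *)

(** * A Jensen inequality for powers *)

(** The graph of t^r lies above its tangent at s; this is Young's inequality for
    t and s^(r-1) with exponents r and r/(r-1). *)
Lemma young_tangent (R : realType) (r s t : R) : 1 < r -> 0 <= s -> 0 <= t ->
  r * (t * powR s (r - 1)) <= powR t r + (r - 1) * powR s r.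
Proof.
move=> r1 s0 t0; have r0 : 0 < r by lra.
have rB0 : 0 < r - 1 by lra.
have q0 : 0 < r / (r - 1) by rewrite divr_gt0.
have pq1 : r^-1 + (r / (r - 1))^-1 = 1.
  by field; apply/andP; split; rewrite gt_eqF.
have := ler_wpM2l (ltW r0) (conjugate_powR t0 (powR_ge0 s (r - 1)) r0 q0 pq1).
rewrite -powRrM [(r - 1) * _]mulrCA divff ?gt_eqF // mulr1.
congr (_ <= _).
by field; apply/andP; split; rewrite gt_eqF.
Qed.

(** The tangent inequality at s = m / P, with m = \sum_i w i * t i, averaged with
    the weights.  The constant term of the tangent, (1-r) s^r, is negative, which
    is why total mass at most P suffices. *)
Lemma jensen_subprob (R : realType) (I : finType) (r P : R) (w t : I -> R) :
  1 < r -> 0 < P -> (forall i, 0 <= w i) -> (forall i, 0 <= t i) ->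
  \sum_i w i <= P ->
  powR (\sum_i w i * t i) r <= powR P (r - 1) * \sum_i w i * powR (t i) r.
Proof.
move=> r1 P0 w0 t0 wP; pose m := \sum_i w i * t i; pose s := m / P.
have m0 : 0 <= m by apply: sumr_ge0 => i _; rewrite mulr_ge0.
have s0 : 0 <= s by rewrite divr_ge0 // ltW.
have eqr (x : R) : 0 <= x -> powR x (r - 1) * x = powR x r.
  by move=> x0; rewrite -{2}(powRr1 x0) -powRD ?subrK //; apply/implyP; lra.
have ms : m = P * s by rewrite /s mulrCA divff ?mulr1 ?gt_eqF.
have tang : r * powR s (r - 1) * m
    <= \sum_i w i * powR (t i) r + (r - 1) * powR s r * \sum_i w i.
  rewrite /m !mulr_sumr -big_split /=; apply: ler_sum => i _.
  have := ler_wpM2l (w0 i) (young_tangent r1 s0 (t0 i)).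
  by congr (_ <= _); ring.
have mass : (r - 1) * powR s r * \sum_i w i <= (r - 1) * powR s r * P.
  by apply: ler_wpM2l => //; rewrite mulr_ge0 ?powR_ge0 //; lra.
have key : P * powR s r <= \sum_i w i * powR (t i) r.
  have : r * powR s (r - 1) * m = r * powR s r * P by rewrite ms -(eqr s) //; ring.
  by nra.
rewrite -/m [in powR m r]ms powRM ?(ltW P0) // -(eqr P) ?(ltW P0) // -mulrA.
by apply: ler_wpM2l => //; apply: powR_ge0.
Qed.

(** * Unitary diagonalization *)

Section UnitaryDiagonalization.
Variables (C : numClosedFieldType) (n : nat).
Implicit Types (A P Q : 'M[C]_n) (d e : 'rV[C]_n).

Definition udiag Q d : 'M[C]_n := Q^t* *m diag_mx d *m Q.

Lemma unitary_tC_mulmx Q : Q \is unitarymx -> Q^t* *m Q = 1%:M.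
Proof. by move=> uQ; rewrite -invmx_unitary // mulVmx // unitarymx_unit. Qed.

Lemma udiag1 Q : Q \is unitarymx -> udiag Q (const_mx 1) = 1%:M.
Proof.
by move=> uQ; rewrite /udiag diag_const_mx mulmx1 unitary_tC_mulmx.
Qed.

Lemma udiag_tC Q d : (udiag Q d)^t* = udiag Q (map_mx Num.Def.conjC d).
Proof.
by rewrite /udiag !trmx_mul !map_mxM trmxCK mulmxA tr_diag_mx map_diag_mx.
Qed.

Lemma udiag_mul Q d e : Q \is unitarymx ->
  udiag Q d *m udiag Q e = udiag Q (\row_j (d 0 j * e 0 j)).
Proof.
move=> uQ; rewrite /udiag !mulmxA mulmxtVK // -(mulmxA (Q^t*) (diag_mx _)).
by rewrite mulmx_diag.
Qed.

Lemma hermsymmxE A : (A \is hermsymmx) = (A == A^t*).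
Proof. by rewrite qualifE /= expr0 scale1r. Qed.

Lemma spectral_udiag A : A \is hermsymmx ->
  A = udiag (spectralmx A) (spectral_diag A).
Proof.
move=> /hermitian_normalmx/orthomx_spectralP eA.
by rewrite {1}eA /udiag -invmx_unitary ?spectral_unitarymx.
Qed.

(** The functional calculus does not depend on the unitary eigenbasis.  The
    change of basis U from one to another satisfies U diag(d) = diag(e) U, so that
    an entry U i j vanishes unless e i = d j; hence U also intertwines the
    diagonal matrices of the images under f. *)
Lemma udiag_map (f : C -> C) P Q e d :
  P \is unitarymx -> Q \is unitarymx -> udiag P e = udiag Q d ->
  udiag P (map_mx f e) = udiag Q (map_mx f d).
Proof.
move=> uP uQ ePQ; pose U := P *m Q^t*.
have PP : P *m P^t* = 1%:M by apply/unitarymxP.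
have UE : U *m diag_mx d = diag_mx e *m U.
  have := congr1 (fun A => P *m A *m Q^t*) ePQ.
  by rewrite /udiag !mulmxA PP mul1mx mulmxtVK // => <-.
have UfE : U *m diag_mx (map_mx f d) = diag_mx (map_mx f e) *m U.
  apply/matrixP => i j; have := congr1 (fun A : 'M_n => A i j) UE.
  rewrite !mul_mx_diag !mul_diag_mx !mxE mulrC => /eqP.
  rewrite -subr_eq0 -mulrBl mulf_eq0 subr_eq0 => /orP[/eqP->|/eqP->].
    by rewrite mulrC.
  by rewrite mulr0 mul0r.
have UQ : U *m Q = P by rewrite /U mulmxKtV.
have PU : P^t* *m U = Q^t* by rewrite /U mulmxA unitary_tC_mulmx // mul1mx.
by rewrite /udiag -[X in _ *m X = _]UQ mulmxA -(mulmxA _ _ U) -UfE mulmxA PU.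
Qed.

Lemma sum_hermsymmx (I : finType) (F : I -> 'M[C]_n) :
  (forall i, F i \is hermsymmx) -> \sum_i F i \is hermsymmx.
Proof.
move=> hF; rewrite hermsymmxE raddf_sum map_mx_sum; apply/eqP.
by apply: eq_bigr => i _; apply/eqP; rewrite -hermsymmxE.
Qed.

Lemma congr_hermsymmx P A : A \is hermsymmx -> P^t* *m A *m P \is hermsymmx.
Proof.
rewrite !hermsymmxE => /eqP hA.
by rewrite !trmx_mul !map_mxM trmxCK -hA mulmxA.
Qed.

Lemma scale_hermsymmx (a : C) A :
  a \is Num.real -> A \is hermsymmx -> a *: A \is hermsymmx.
Proof.
rewrite !hermsymmxE => /CrealP aR /eqP hA.
by rewrite linearZ /= map_mxZ -hA; apply/eqP; congr (_ *: _); rewrite [RHS]aR.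
Qed.

Lemma mulmx_col P Q j : P *m col j Q = col j (P *m Q).
Proof. by rewrite !colE mulmxA. Qed.

End UnitaryDiagonalization.

(** * Real quadratic forms and powers of Hermitian matrices *)

Section QuadraticForms.
Variables (R : realType) (n : nat).
Implicit Types (A B X Q V : 'M[R[i]]_n) (x : 'cV[R[i]]_n) (d e : 'rV[R]_n).

Definition sqmod (z : R[i]) : R := complex.Re z ^+ 2 + complex.Im z ^+ 2.

(** Taking the real part makes the form real-valued and real-linear in the matrix
    for every matrix; it loses nothing when the matrix is Hermitian. *)
Definition qform A x : R := complex.Re ((x ^t* *m (A *m x)) 0 0).

Definition rudiag Q d : 'M[R[i]]_n := udiag Q (map_mx (real_complex R) d).

Lemma sqmodE z : (sqmod z)%:C = z^* * z.
Proof. by rewrite /sqmod add_Re2_Im2 normCK mulrC. Qed.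

Lemma sqmod_ge0 z : 0 <= sqmod z.
Proof. by rewrite addr_ge0 ?sqr_ge0. Qed.

Lemma qform_rudiag Q d x :
  qform (rudiag Q d) x = \sum_i d 0 i * sqmod ((Q *m x) i 0).
Proof.
rewrite /qform /rudiag /udiag -[RHS]/(complex.Re (_%:C)); congr complex.Re.
rewrite !mulmxA -2!mulmxA.
have -> : x ^t* *m Q ^t* = (Q *m x)^t* by rewrite trmx_mul map_mxM.
rewrite mul_diag_mx mxE rmorph_sum; apply: eq_bigr => i _ /=.
by move: (Q *m x) => y; rewrite !mxE rmorphM /= sqmodE mulrCA.
Qed.

Lemma qform_sum (I : finType) (F : I -> 'M[R[i]]_n) x :
  qform (\sum_i F i) x = \sum_i qform (F i) x.
Proof.
have ReD : {morph (@complex.Re R) : u v / u + v} by move=> [? ?] [? ?].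
rewrite /qform mulmx_suml mulmx_sumr summxE.
exact: (big_morph (@complex.Re R) ReD erefl).
Qed.

Lemma qformZ a A x : qform (a%:C *: A) x = a * qform A x.
Proof.
rewrite /qform -scalemxAl -scalemxAr mxE.
by case: (_ 0 0) => u v /=; rewrite mul0r subr0.
Qed.

Lemma qform_congr X A x : qform (X^t* *m A *m X) x = qform A (X *m x).
Proof. by rewrite /qform trmx_mul map_mxM !mulmxA. Qed.

Lemma loewner_qform A B x : loewner_le A B -> qform A x <= qform B x.
Proof. by move=> /(_ x); rewrite lecE => /andP[]. Qed.

Lemma rudiag1 Q : Q \is unitarymx -> rudiag Q (const_mx 1) = 1%:M.
Proof. by move=> uQ; rewrite /rudiag map_const_mx udiag1. Qed.

Lemma qform1 Q x : Q \is unitarymx -> qform 1%:M x = \sum_i sqmod ((Q *m x) i 0).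
Proof.
move=> uQ; rewrite -(rudiag1 uQ) qform_rudiag; apply: eq_bigr => i _.
by rewrite mxE mul1r.
Qed.

Lemma qform_eigenvector Q d j : Q \is unitarymx ->
  qform (rudiag Q d) (col j (Q^t*)) = d 0 j.
Proof.
move=> uQ; rewrite qform_rudiag (bigD1 j) //= big1 => [|i ij].
  by rewrite mulmx_col (unitarymxP uQ) !mxE eqxx /sqmod /= expr1n expr0n !addr0 mulr1.
by rewrite mulmx_col (unitarymxP uQ) !mxE (negPf ij) /sqmod /= expr0n addr0 mulr0.
Qed.

Lemma rudiag_herm Q d : rudiag Q d \is hermsymmx.
Proof.
rewrite hermsymmxE udiag_tC -map_mx_comp; apply/eqP; congr udiag.
by apply/matrixP => i j; rewrite !mxE; apply/esym/conjc_real.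
Qed.

Lemma spectral_rudiag A : A \is hermsymmx ->
  A = rudiag (spectralmx A) (map_mx (@complex.Re R) (spectral_diag A)).
Proof.
move=> hA; have /mxOverP dreal := hermitian_spectral_diag_real hA.
rewrite {1}(spectral_udiag hA); congr udiag.
by apply/matrixP => i j; rewrite !mxE ord1 [RHS]RRe_real.
Qed.

Lemma mx_calculus_rudiag f Q d : Q \is unitarymx ->
  mx_calculus f (rudiag Q d) = rudiag Q (map_mx f d).
Proof.
move=> uQ; set A := rudiag Q d; have uA := spectral_unitarymx A.
rewrite /mx_calculus invmx_unitary // -/(udiag _ _).
rewrite (udiag_map _ uA uQ (esym (spectral_udiag (rudiag_herm Q d)))).
by congr udiag; apply/matrixP => i j; rewrite !mxE.
Qed.

(** |A|^r is diagonal in the eigenbasis of A, although it is built from the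
    eigenbases of A^* A and of |A|. *)
Lemma mx_pow_abs_spectral r A : A \is hermsymmx ->
  mx_pow (mx_abs A) r =
  rudiag (spectralmx A) (\row_j powR `|complex.Re (spectral_diag A 0 j)| r).
Proof.
move=> hA; have uP := spectral_unitarymx A.
have sq : A^t* *m A =
  rudiag (spectralmx A) (\row_j (complex.Re (spectral_diag A 0 j) ^+ 2)).
  have /eqP <- : A == A^t* by rewrite -hermsymmxE.
  rewrite {1 2}(spectral_rudiag hA) (udiag_mul _ _ uP); congr udiag.
  by apply/matrixP=> i j; rewrite !mxE expr2 rmorphM.
rewrite /mx_pow /mx_abs sq /mx_pow 2!(mx_calculus_rudiag _ _ uP); congr rudiag.
by apply/matrixP=> i j; rewrite !mxE powR12_sqrt ?sqr_ge0 // sqrtr_sqr.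
Qed.

(** * Sums of largest eigenvalues *)

Definition topsum k d : R :=
  \sum_(0 <= j < k) (sort >=%R [seq d 0 i | i : 'I_n])`_j.

(** The largest k entries sit at the positions of some set S, and are separated
    from the others by a threshold t, namely the k-th largest entry.  The
    threshold is what comparisons with other weightings use. *)
Lemma topsum_set k d : (0 < k <= n)%N ->
  exists (S : {set 'I_n}) (t : R),
    [/\ #|S| = k, topsum k d = \sum_(i in S) d 0 i,
        forall i, i \in S -> t <= d 0 i & forall i, i \notin S -> d 0 i <= t].
Proof.
move=> /andP[k0 kn]; pose s := sort >=%R [seq d 0 i | i : 'I_n].
pose e := sort (relpre (d 0) >=%R) (enum 'I_n).
have sE : s = map (d 0) e by rewrite /s -sort_map.
have sze : size e = n by rewrite size_sort size_enum_ord.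
have ue : uniq e by rewrite sort_uniq enum_uniq.
have mem_e i : i \in e by rewrite mem_sort mem_enum.
have srt : sorted >=%R s by apply: sort_sorted => x y; rewrite orbC le_total.
have s_mono i j : (i <= j < n)%N -> s`_j <= s`_i.
  move=> /andP[ij jn]; have := sorted_leq_nth (rev_trans le_trans) lexx 0 srt.
  by move=> /(_ i j); rewrite !inE sE size_map sze; apply=> //; apply: leq_ltn_trans jn.
have hs i : d 0 i = s`_(index i e).
  by rewrite sE (nth_map i) ?nth_index // index_mem.
(* [e] lists the indices by decreasing entries; k > 0 makes [k.-1] the position
   of the last entry taken. *)
exists [set i in take k e], (s`_k.-1); split.
- rewrite cardsE (card_uniqP _) ?take_uniq // size_take sze.
  by case: ltngtP kn.
- rewrite /topsum -/s (eq_bigl (mem (take k e))); last by move=> i; rewrite inE.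
  rewrite -big_uniq ?take_uniq // -(big_map (d 0) predT id) map_take.
  rewrite -sE [RHS](big_nth 0) size_take sE size_map sze.
  have -> : (if (k < n)%N then k else n) = k by case: ltngtP kn.
  by apply: eq_big_nat => j /andP[_ jk]; rewrite nth_take.
- move=> i; rewrite inE in_take // hs => ik; apply: s_mono.
  by rewrite -ltnS prednK // ik /= (leq_trans _ kn).
- move=> i; rewrite inE in_take // -leqNgt hs => ki; apply: s_mono.
  rewrite (leq_trans (leq_pred _) ki) /=.
  by rewrite -[n in X in (_ < X)%N]sze index_mem.
Qed.

(** The difference of the two sides is the sum of (d_i - t) (1_S(i) - c i), since
    1_S and c have the same total; both factors have the same sign. *)
Lemma weighted_sum_le_topsum k d (c : 'I_n -> R) : (0 < k <= n)%N ->
  (forall i, 0 <= c i <= 1) -> \sum_i c i = k%:R ->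
  \sum_i d 0 i * c i <= topsum k d.
Proof.
move=> hk c01 ck; have [S [t [cS -> hS hNS]]] := topsum_set d hk.
rewrite -subr_ge0.
have -> : \sum_(i in S) d 0 i - \sum_i d 0 i * c i
    = \sum_i (d 0 i - t) * ((i \in S)%:R - c i).
  have cardS : \sum_i (i \in S)%:R = k%:R :> R.
    rewrite -cS -sum1_card natr_sum big_mkcond [RHS]big_mkcond /=.
    by apply: eq_bigr => i _; case: (i \in S).
  under [RHS]eq_bigr do rewrite mulrBl mulrBr (mulrBr t).
  rewrite !sumrB -!mulr_sumr ck cardS subrr subr0; congr (_ - _).
  rewrite big_mkcond; apply: eq_bigr => i _.
  by case: (i \in S); rewrite ?mulr1 ?mulr0.
apply: sumr_ge0 => i _; have /andP[c0 c1] := c01 i.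
have [iS|iS] := boolP (i \in S).
  by rewrite mulr_ge0 ?subr_ge0 ?hS.
by rewrite mulr_le0 ?subr_le0 ?hNS // sub0r oppr_le0.
Qed.

(** Ky Fan's maximum principle.  With U = Q V^*, the left-hand side is the sum of
    the d_i with weights c_i = \sum_(j in S) |U i j|^2.  As the rows and columns
    of |U i j|^2 sum to 1, the weights lie in [0, 1] and have total k. *)
Lemma ky_fan k d Q V (S : {set 'I_n}) : (0 < k <= n)%N ->
  Q \is unitarymx -> V \is unitarymx -> #|S| = k ->
  \sum_(j in S) qform (rudiag Q d) (col j (V^t*)) <= topsum k d.
Proof.
move=> hk uQ uV cS; pose U := Q *m V^t*.
have uU : U \is unitarymx.
  by apply: mul_unitarymx uQ _; rewrite trmxC_unitary.
have rowU i : \sum_j sqmod (U i j) = 1.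
  have := congr1 (fun M : 'M_n => complex.Re (M i i)) (unitarymxP uU).
  rewrite !mxE eqxx /= => <-; rewrite -[LHS]/(complex.Re (_%:C)) rmorph_sum.
  by congr complex.Re; apply: eq_bigr => j _; rewrite /= sqmodE mulrC !mxE.
(* Column j of U = Q V^* is the image under Q of a unit vector. *)
have colU j : \sum_i sqmod (U i j) = 1.
  have := qform_eigenvector (const_mx 1) j uV.
  rewrite rudiag1 // (qform1 _ uQ) mulmx_col mxE => <-.
  by apply: eq_bigr => i _; rewrite [in RHS]mxE.
under eq_bigr do rewrite qform_rudiag mulmx_col.
rewrite exchange_big /=.
under eq_bigr => i _ do rewrite -mulr_sumr.
apply: weighted_sum_le_topsum => // [i|].
  rewrite sumr_ge0 => [|j _]; last exact: sqmod_ge0.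
  rewrite -(rowU i) [leRHS](bigID (mem S)) /=.
  under eq_bigr do rewrite mxE.
  by rewrite lerDl sumr_ge0 // => j _; apply: sqmod_ge0.
rewrite exchange_big /= -cS -sum1_card natr_sum; apply: eq_bigr => j _.
by rewrite -(colU j); apply: eq_bigr => i _; rewrite mxE.
Qed.

Lemma sum_lambda k A :
  \sum_(1 <= j < k.+1) lambda j A
  = topsum k (map_mx (@complex.Re R) (spectral_diag A)).
Proof.
rewrite /topsum big_add1 /=; apply: eq_bigr => j _; rewrite /lambda /eigenvalues.
by congr (sort _ _)`_ _; apply: eq_map => i; rewrite mxE.
Qed.

Lemma sum_qform_le_lambda k A V (S : {set 'I_n}) : (0 < k <= n)%N ->
  A \is hermsymmx -> V \is unitarymx -> #|S| = k ->
  \sum_(j in S) qform A (col j (V^t*)) <= \sum_(1 <= j < k.+1) lambda j A.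
Proof.
move=> hk hA uV cS; rewrite sum_lambda.
under eq_bigr do rewrite [X in qform X _](spectral_rudiag hA).
exact: ky_fan (spectral_unitarymx A) uV cS.
Qed.

(** Ky Fan's inequality, with the k largest eigenvalues written as values of the
    form at the eigenvectors that the spectral decomposition provides. *)
Lemma sum_lambda_rudiag_le k d Q : (0 < k <= n)%N -> Q \is unitarymx ->
  \sum_(1 <= j < k.+1) lambda j (rudiag Q d) <= topsum k d.
Proof.
move=> hk uQ; rewrite sum_lambda; set H := rudiag Q d.
have hH : H \is hermsymmx := rudiag_herm Q d.
have uH := spectral_unitarymx H.
have [S [t [cS -> _ _]]] :=
  topsum_set (map_mx (@complex.Re R) (spectral_diag H)) hk.
apply: le_trans (ky_fan d hk uQ uH cS).
apply: ler_sum => j _.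
by rewrite -/H [X in _ <= qform X _](spectral_rudiag hH) qform_eigenvector.
Qed.

End QuadraticForms.

(** * The inequality for one vector *)

(** Jensen's inequality with weights p_i^(1/(1-r)) w_im and values
    |a_im| p_i^(1/(r-1)), where the a_im are the eigenvalues of A_i and the w_im
    are the squared moduli of the coordinates of X_i x in the eigenbasis of A_i.
    The sum of w_im over m is <X_i x, X_i x>, so that the last assumption bounds
    the total weight. *)
Lemma powR_qform_le (R : realType) (n l : nat) (r : R) (p : 'I_l -> R)
  (A X : 'I_l -> 'M[R[i]]_n) (x : 'cV[R[i]]_n) :
  (0 < l)%N -> 1 < r -> (forall i, 0 < p i) -> (forall i, A i \is hermsymmx) ->
  \sum_i powR (p i) (1 / (1 - r)) * qform 1%:M (X i *m x)
    <= \sum_i powR (p i) (1 / (1 - r)) ->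
  powR `|qform (\sum_i (X i)^t* *m A i *m X i) x| r
  <= powR (\sum_i powR (p i) (1 / (1 - r))) (r - 1)
     * qform (\sum_i (p i)%:C *: ((X i)^t* *m mx_pow (mx_abs (A i)) r *m X i)) x.
Proof.
move=> l0 r1 p0 hA mass.
pose a i m : R := complex.Re (spectral_diag (A i) 0 m).
pose w i m : R := sqmod ((spectralmx (A i) *m (X i *m x)) m 0).
pose c i := powR (p i) (1 / (1 - r)).
have c0 i : 0 < c i by rewrite powR_gt0.
have w0 i m : 0 <= w i m by apply: sqmod_ge0.
have P0 : 0 < \sum_i c i.
  rewrite (bigD1 (Ordinal l0)) //= ltr_wpDr // sumr_ge0 // => i _.
  exact: ltW.
(* In weight times value, and in weight times value to the r, the powers of
   p_i multiply to 1 and to p_i. *)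
have expV : 1 / (1 - r) + 1 / (r - 1) = 0 by field; apply/andP; split; lra.
have exp1 : 1 / (1 - r) + 1 / (r - 1) * r = 1 by field; apply/andP; split; lra.
have cV i : c i * powR (p i) (1 / (r - 1)) = 1.
  by rewrite /c -powRD ?(gt_eqF (p0 i)) ?implybT // expV powRr0.
have cp i : c i * powR (powR (p i) (1 / (r - 1))) r = p i.
  rewrite -powRrM /c -powRD ?(gt_eqF (p0 i)) ?implybT // exp1.
  exact: powRr1 (ltW (p0 i)).
have -> : qform (\sum_i (p i)%:C *: ((X i)^t* *m mx_pow (mx_abs (A i)) r *m X i)) x
    = \sum_i \sum_m c i * w i m * powR (`|a i m| * powR (p i) (1 / (r - 1))) r.
  rewrite qform_sum; apply: eq_bigr => i _.
  rewrite qformZ qform_congr (mx_pow_abs_spectral _ (hA i)) qform_rudiag mulr_sumr.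
  apply: eq_bigr => m _; rewrite mxE powRM ?powR_ge0 ?normr_ge0 // -{1}(cp i).
  by rewrite -/(w i m) -/(a i m); ring.
have le_abs : `|qform (\sum_i (X i)^t* *m A i *m X i) x|
    <= \sum_i \sum_m c i * w i m * (`|a i m| * powR (p i) (1 / (r - 1))).
  rewrite qform_sum; apply: le_trans (ler_norm_sum _ _ _) _.
  apply: ler_sum => i _; rewrite qform_congr (spectral_rudiag (hA i)) qform_rudiag.
  apply: le_trans (ler_norm_sum _ _ _) _; apply: ler_sum => m _.
  rewrite mxE normrM (ger0_norm (w0 i m)) -/(a i m).
  have -> : c i * w i m * (`|a i m| * powR (p i) (1 / (r - 1)))
    = `|a i m| * w i m * (c i * powR (p i) (1 / (r - 1))) by ring.
  by rewrite cV mulr1.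
apply: (@le_trans _ _
  (powR (\sum_i \sum_m c i * w i m * (`|a i m| * powR (p i) (1 / (r - 1)))) r)).
  apply: ge0_ler_powR => //; rewrite ?nnegrE ?normr_ge0 //; first by lra.
  exact: le_trans (normr_ge0 _) le_abs.
rewrite !pair_big /=.
apply: (jensen_subprob (w := fun q : 'I_l * 'I_n => c q.1 * w q.1 q.2)
  (t := fun q => `|a q.1 q.2| * powR (p q.1) (1 / (r - 1)))) => //.
- by move=> q; rewrite mulr_ge0 // ltW.
- by move=> q; rewrite mulr_ge0 ?powR_ge0.
rewrite -(pair_big xpredT xpredT (fun i m => c i * w i m)) /=.
apply: le_trans mass; apply: ler_sum => i _.
by rewrite (qform1 _ (spectral_unitarymx (A i))) mulr_sumr.
Qed.

(** * Summation over eigenvectors *)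

Theorem theorem2p9 (R : realType) (n l : nat) (hn : (0 < n)%N) (hl : (0 < l)%N)
  (r : R) (hr : 1 < r)
  (p : 'I_l -> R) (hp : forall i, 0 < p i)
  (A : 'I_l -> 'M[R[i]]_n) (hA : forall i, A i \is hermsymmx)
  (X : 'I_l -> 'M[R[i]]_n)
  (hX : loewner_le
          (\sum_(i < l) (powR (p i) (1 / (1 - r)))%:C *: ((X i) ^t* *m X i))
          ((\sum_(i < l) powR (p i) (1 / (1 - r)))%:C *: 1%:M))
  (k : nat) (hk : (1 <= k <= n)%N) :
  \sum_(1 <= j < k.+1)
     lambda j (mx_pow (mx_abs (\sum_(i < l) (X i) ^t* *m A i *m X i)) r)
  <= powR (\sum_(i < l) powR (p i) (1 / (1 - r))) (r - 1)
     * \sum_(1 <= j < k.+1)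
         lambda j (\sum_(i < l)
                     (p i)%:C *: ((X i) ^t* *m mx_pow (mx_abs (A i)) r *m X i)).
Proof.
set B := \sum_(i < l) (X i)^t* *m A i *m X i.
set C := \sum_(i < l) (p i)%:C *: _.
set P := \sum_(i < l) powR (p i) (1 / (1 - r)).
have hB : B \is hermsymmx by apply: sum_hermsymmx => i; apply: congr_hermsymmx.
have hC : C \is hermsymmx.
  apply: sum_hermsymmx => i; apply: scale_hermsymmx _ _; first by rewrite complex_real.
  apply: congr_hermsymmx; rewrite mx_pow_abs_spectral; last exact: hA.
  exact: rudiag_herm.
have uB := spectral_unitarymx B; set Q := spectralmx B in uB.
pose b j : R := complex.Re (spectral_diag B 0 j).
rewrite (mx_pow_abs_spectral _ hB) -/Q.
apply: le_trans (sum_lambda_rudiag_le _ hk uB) _.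
have [S [t [cS -> _ _]]] := topsum_set (\row_j powR `|b j| r) hk.
apply: le_trans (ler_wpM2l (powR_ge0 _ _) (sum_qform_le_lambda hk hC uB cS)).
rewrite mulr_sumr; apply: ler_sum => j _; rewrite mxE.
have -> : b j = qform B (col j (Q^t*)).
  by rewrite [X in qform X _](spectral_rudiag hB) (qform_eigenvector _ _ uB) mxE.
apply: powR_qform_le => //.
have one : qform 1%:M (col j (Q^t*)) = 1.
  by rewrite -(rudiag1 uB) (qform_eigenvector _ _ uB) mxE.
have := loewner_qform (col j (Q^t*)) hX.
rewrite qformZ one mulr1 qform_sum; congr (_ <= _).
by apply: eq_bigr => i _; rewrite qformZ -qform_congr mulmx1.
Qed.
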